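(* Let $p$ be an odd prime and $i\in\{1,2\}$. Then $p$ is rogue of the $i^{\text{th}}$ kind if and only if $2$ is not a primitive root modulo $p$.
   Context: For an odd prime $p$ and $i\in\{1,2\}$, let $A_i^p=(\mathbb{Z}/p\mathbb{Z})^\times\setminus\{(-1)^i \bmod p\}$. For $g\in A_i^p$ define $u_1=g$ and $u_n=2u_{n-1}+(-1)^{i+1}$ in $\mathbb{Z}/p\mathbb{Z}$ for $n>1$; let $g_k^i=\min(\{n\in\mathbb{N}: u_n=0\}\cup\{\infty\})$, and call $\langle g\rangle_i^p=(u_n)_{1\le n<g_k^i}$ the rogue sequence of $g$. A rogue sequence which is periodic (equivalently, never reaches $0$, so $g_k^i=\infty$) is called a rogue loop. The prime $p$ is rogue of the $i^{\text{th}}$ kind if there exists $g\in A_i^p$ such that $\langle g\rangle_i^p$ is a rogue loop. *)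

(* Defs.v *)
From HB Require Import structures.
From mathcomp Require Import all_boot all_order all_algebra.
From mathcomp Require Import boolp.

Set Implicit Arguments.
Unset Strict Implicit.
Unset Printing Implicit Defensive.

Import GRing.Theory.
Local Open Scope ring_scope.

(* 'F_p is Z/pZ only when p is prime. *)
Definition A (i p : nat) : {set 'F_p} :=
  [set g : 'F_p | (g \is a GRing.unit) && (g != (-1) ^+ i)].

(* Indices start at 1: u i g 1 = g. The value at index 0 is junk and is never
   used. *)
Definition u (p i : nat) (g : 'F_p) (n : nat) : 'F_p :=
  iter n.-1 (fun x : 'F_p => 2 * x + (-1) ^+ i.+1) g.

Definition hits0 (p i : nat) (g : 'F_p) : pred nat :=
  fun n => (0 < n)%N && (u i g n == 0).

(* g_k^i, as an element of the positive integers extended by None = infinity. *)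
Definition rogue_index (p i : nat) (g : 'F_p) : option nat :=
  if pselect (exists n, hits0 i g n) is left ex then Some (ex_minn ex)
  else None.

Definition lt_ext (n : nat) (b : option nat) : bool :=
  if b is Some m then (n < m)%N else true.

(* A finite or infinite sequence (s_n)_{1 <= n < b} is represented by a function
   that is None exactly at the indices outside its domain. *)
Definition rogue_seq (p i : nat) (g : 'F_p) (n : nat) : option 'F_p :=
  if (0 < n)%N && lt_ext n (rogue_index i g) then Some (u i g n) else None.

(* A periodic sequence is in particular infinite. *)
Definition periodic (T : Type) (s : nat -> option T) : Prop :=
  (forall n, (0 < n)%N -> s n <> None) /\
  (exists2 t, (0 < t)%N & forall n, (0 < n)%N -> s (n + t)%N = s n).

Definition rogue_loop (p i : nat) (g : 'F_p) : Prop := periodic (rogue_seq i g).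

Definition rogue (i p : nat) : Prop := exists2 g, g \in A i p & rogue_loop i g.

(* For a prime p: the class of a has multiplicative order totient p modulo p. *)
Definition primitive_root_mod (a p : nat) : Prop :=
  (totient p).-primitive_root (a%:R : 'F_p).

(* Main.v *)
(** The step [x |-> 2 x - c], with [c = (-1)^i], fixes [c], so that
    [u_(n+1) - c = 2^n (g - c)], and for [g != c] the sequence reaches [0] if
    and only if [c / (c - g)] is a power of [2].  As [g] runs through [A_i],
    the quotient [c / (c - g)] runs through all units except [1 = 2^0].  Hence
    some [g] never reaches [0] if and only if the powers of [2] miss a unit.
    Never reaching [0] already forces periodicity, because the step is a
    permutation of a finite set. *)
Require Import Defs.
From HB Require Import structures.
From mathcomp Require Import all_boot all_order all_algebra.
From mathcomp Require Import finfield boolp.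

Set Implicit Arguments.
Unset Strict Implicit.
Unset Printing Implicit Defensive.

Import GRing.Theory.

Section AffineIteration.
Local Open Scope ring_scope.

Lemma iter_affine (R : pzRingType) (a b c x : R) n :
  a * c + b = c -> iter n (fun y => a * y + b) x = a ^+ n * (x - c) + c.
Proof.
move=> fix_c; elim: n => [|n IHn]; first by rewrite expr0 mul1r subrK.
by rewrite iterS IHn mulrDr mulrA -exprS -addrA fix_c.
Qed.

Lemma iter_affine_eq0 (F : fieldType) (a b c x : F) n :
    a * c + b = c -> x != c ->
  (iter n (fun y => a * y + b) x == 0) = (a ^+ n == c / (c - x)).
Proof.
move=> fix_c x_neq_c; have cx_neq0 : c - x != 0 by rewrite subr_eq0 eq_sym.
rewrite (iter_affine _ _ fix_c) -(opprB c x) mulrN addrC subr_eq0 eq_sym.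
exact: can2_eq (mulfK cx_neq0) (divfK cx_neq0) _ _.
Qed.

End AffineIteration.

Section FinFieldPrimitiveRoots.
Local Open Scope ring_scope.
Variable F : finFieldType.

Lemma expf_card_pred (x : F) : x != 0 -> x ^+ #|F|.-1 = 1.
Proof.
move=> x_neq0; apply: (mulfI x_neq0).
by rewrite mulr1 -exprS prednK ?expf_card // ltnW ?finNzRing_gt1.
Qed.

Lemma leq_finField_exponent n :
  (0 < n)%N -> (forall x : F, x != 0 -> x ^+ n = 1) -> (#|F|.-1 <= n)%N.
Proof.
move=> n_gt0 expn1; rewrite -(cardsC1 (0 : F)) cardE.
apply: max_unity_roots (enum_uniq _) => //; apply/allP => x.
by rewrite mem_enum !inE unity_rootE => /expn1 ->.
Qed.

Lemma finField_primitive_rootP (z : F) : z != 0 ->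
  #|F|.-1.-primitive_root z <-> forall x, x != 0 -> exists n, z ^+ n = x.
Proof.
move=> z_neq0; split=> [z_prim x /expf_card_pred x_unity | powers].
  by have [n ->] := prim_rootP z_prim x_unity; exists n.
have pred_gt0 : (0 < #|F|.-1)%N by rewrite -subn1 subn_gt0 finNzRing_gt1.
have [d z_prim d_dvd] := prim_order_exists pred_gt0 (expf_card_pred z_neq0).
suff -> : #|F|.-1 = d by [].
apply/eqP; rewrite eqn_leq (dvdn_leq pred_gt0 d_dvd) andbT.
apply: leq_finField_exponent => [|_ /powers[n <-]].
  exact: prim_order_gt0 z_prim.
by rewrite exprAC (prim_expr_order z_prim) expr1n.
Qed.

End FinFieldPrimitiveRoots.

Section RogueSequences.
Local Open Scope ring_scope.
Variables p i : nat.
Implicit Type g : 'F_p.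

Lemma rogue_index_hits0 g m : rogue_index i g = Some m -> hits0 i g m.
Proof.
by rewrite /rogue_index; case: pselect => // ex [<-]; case: ex_minnP.
Qed.

Lemma rogue_index_NoneP g :
  rogue_index i g = None <-> forall n, u i g n.+1 != 0.
Proof.
rewrite /rogue_index; case: pselect => [hit|nohit]; split=> //.
  by have [[//|n] /= /eqP un0] := hit => /(_ n); rewrite un0 eqxx.
by move=> _ n; apply/negP => un0; apply: nohit; exists n.+1.
Qed.

Lemma rogue_seq_infiniteP g :
  (forall n, (0 < n)%N -> rogue_seq i g n <> None) <-> rogue_index i g = None.
Proof.
split=> [infinite | noindex n n_gt0]; last by rewrite /rogue_seq noindex n_gt0.
case index_m: (rogue_index i g) => [m|//].
have /andP[m_gt0 _] := rogue_index_hits0 index_m.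
by have := infinite m m_gt0; rewrite /rogue_seq index_m /= ltnn andbF.
Qed.

Lemma uS_eq0 g n : g != (-1) ^+ i ->
  (u i g n.+1 == 0) = (2 ^+ n == (-1) ^+ i / ((-1) ^+ i - g)).
Proof.
by apply: iter_affine_eq0; rewrite exprS mulN1r mulr_natl mulr2n addrK.
Qed.

Hypothesis two_neq0 : (2 : 'F_p) != 0.

Lemma u_periodic g :
  exists2 t, (0 < t)%N & forall n, (0 < n)%N -> u i g (n + t) = u i g n.
Proof.
pose step (x : 'F_p) : 'F_p := 2 * x + (-1) ^+ i.+1.
have step_inj : injective step by move=> x y /addIr/(mulfI two_neq0).
exists (order step g) => [|[//|n] _]; first exact: order_gt0.
by rewrite /u addSn /= iterD iter_order.
Qed.

Lemma rogue_loopP g : rogue_loop i g <-> forall n, u i g n.+1 != 0.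
Proof.
rewrite -rogue_index_NoneP -rogue_seq_infiniteP; split=> [[]//|infinite].
split=> //; have [t t_gt0 periodic_u] := u_periodic g; exists t => // n n_gt0.
have /rogue_seq_infiniteP noindex := infinite.
by rewrite /rogue_seq noindex /= addn_gt0 n_gt0 periodic_u.
Qed.

Lemma rogue_missing_powerP :
  rogue i p <-> exists2 h : 'F_p, h != 0 & ~ exists n, 2 ^+ n = h.
Proof.
pose c : 'F_p := (-1) ^+ i; have c_neq0 : c != 0 by rewrite signr_eq0.
split=> [[g] | [h h_neq0 h_nopower]].
  rewrite inE => /andP[_ g_neq_c] /rogue_loopP nonzero.
  exists (c / (c - g)); first by rewrite mulf_neq0 // invr_eq0 subr_eq0 eq_sym.
  by case=> n /eqP; rewrite -uS_eq0 //; exact/negP.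
have c_div_h : c - (c - c / h) = c / h by rewrite subKr.
have g_neq_c : c - c / h != c.
  by rewrite -subr_eq0 addrC addKr oppr_eq0 mulf_neq0 ?invr_eq0.
exists (c - c / h).
  rewrite inE g_neq_c andbT unitfE subr_eq0; apply/eqP => c_eq.
  by apply: h_nopower; exists 0%N; rewrite -(divKf c_neq0 h) -c_eq divff.
apply/rogue_loopP => n; rewrite uS_eq0 // c_div_h divKf //.
by apply/eqP => h_power; apply: h_nopower; exists n.
Qed.

End RogueSequences.

Section PrimeField.
Local Open Scope ring_scope.
Variable p : nat.
Hypothesis p_prime : prime p.

Lemma Fp_two_neq0 : odd p -> (2 : 'F_p) != 0.
Proof.
move=> p_odd; rewrite -(dvdn_pcharf (pchar_Fp p_prime)).
by rewrite dvdn_prime2 //; apply: contraL p_odd => /eqP ->.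
Qed.

Lemma primitive_root_modP a : (a%:R : 'F_p) != 0 ->
  primitive_root_mod a p <->
  forall x : 'F_p, x != 0 -> exists n, a%:R ^+ n = x.
Proof.
rewrite /primitive_root_mod totient_prime // -[X in X.-1](card_Fp p_prime).
exact: finField_primitive_rootP.
Qed.

End PrimeField.

Theorem mainTheorem2 (p i : nat) (p_prime : prime p) (p_odd : odd p)
  (hi : i = 1 \/ i = 2) :
  rogue i p <-> ~ primitive_root_mod 2 p.
Proof.
have two_neq0 := Fp_two_neq0 p_prime p_odd.
rewrite (rogue_missing_powerP i two_neq0) existsPNP.
by rewrite (primitive_root_modP p_prime two_neq0).
Qed.
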